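(* Suppose $\Gamma$ is a locally weakly independent lattice configuration in $\mathfrak B_d$. Then each sub-representation of $M_\Gamma$ (of any dimension vector) is decomposable into a direct sum of sub-representations, where each summand is generated by a single vector, hence has dimension at most $\mathbf 1=(1,\dots,1)$. Moreover, $M_\Gamma$ is projective, hence $\Gamma$ is contained in an apartment.
   Context: $R$ is a discrete valuation ring with fraction field $K$, uniformizer $\pi$ and algebraically closed residue field $\kappa$; $d$ is a positive integer. A lattice in $K^d$ is a free $R$-submodule $L\subset K^d$ with $L\otimes_RK\to K^d$ an isomorphism; $[L]$ is its homothety class. Distinct classes are adjacent if they have representatives with $\pi L_1\subset L_2\subset L_1$; $\mathfrak B_d$ is the flag complex of homothety classes under adjacency. A convex lattice configuration is a finite nonempty set $\Gamma$ of classes such that $[L_1\cap L_2]\in\Gamma$ for any representatives $L_1,L_2$ of two members of $\Gamma$. Write $\Gamma=\{[L_v]\}_v$ with fixed representatives and identify $\Gamma$ with the index set. For $u,v\in\Gamma$ let $n_{u,v}$ be the minimal integer with $\pi^{n_{u,v}}L_u\subset L_v$, put $\overline L_v=L_v/\pi L_v$, and let $f_{u,v}:\overline L_u\to\overline L_v$ be induced by multiplication by $\pi^{n_{u,v}}$. $f_{u,v}$ factors through $w$ if $f_{u,v}=f_{w,v}\circ f_{u,w}$. $Q(\Gamma)'$ is the quiver with vertex set $\Gamma$ and one arrow $(u,v)$ for each ordered pair $u\ne v$. $Q(\Gamma)$ is obtained from it by removing every arrow $(u,v)$ for which some path of length $\ge2$ from $u$ to $v$ in $Q(\Gamma)'$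 has composite map equal to $f_{u,v}$. $M_\Gamma=(\overline L_v)_v$ is the representation of $Q(\Gamma)$ with maps $f_{u,v}$. ''Projective'' means projective as a module over the path algebra of $Q(\Gamma)$ modulo the relations satisfied by $M_\Gamma$ (paths with zero composite are zero; parallel paths with the same composite are equal); concretely, a sub-representation of $M_\Gamma$ is projective iff it is a direct sum of sub-representations each generated by one vector $x\in\overline L_v$ with $f_{v,w}(x)\neq0$ for all $w\in\Gamma$. A convex $\Gamma$ is locally weakly independent at $v$ if there is $I_v\subset\Gamma\setminus\{v\}$ such that (1) for each $u\ne v$, $f_{u,v}$ factors through some $w\in I_v$; (2) $\{\operatorname{Im} f_{w,v}=\ker f_{v,w}\}_{w\in I_v}$ are linearly independent subspaces of $\overline L_v$. It is locally weakly independent if it is so at every $v\in\Gamma$. $\Gamma$ is contained in an apartment if there is a basis $e_1,\dots,e_d$ of $K^d$ such that every class in $\Gamma$ has the form $[\langle\pi^{c_1}e_1,\dots,\pi^{c_d}e_d\rangle]$, $c_i\in\mathbb Z$. *)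

(* Defs.v *)
From HB Require Import structures.
From mathcomp Require Import all_boot all_order all_algebra.
From mathcomp Require Import boolp classical_sets.

Set Implicit Arguments.
Unset Strict Implicit.
Unset Printing Implicit Defensive.

Import Order.TTheory GRing.Theory Num.Theory.
Local Open Scope classical_set_scope.
Local Open Scope ring_scope.
Local Open Scope quotient_scope.

(* A discrete valuation ring, with a chosen uniformizer and a chosen model     *)
(* [residue_map : R -> kappa] of the quotient of R by its maximal ideal (pi).  *)
Record dvr := Dvr {
  dvr_ring :> idomainType;
  uniformizer : dvr_ring;
  residue_field : fieldType;
  residue_map : {rmorphism dvr_ring -> residue_field};
  uniformizer_neq0 : uniformizer != 0;
  uniformizer_nonunit : uniformizer \isn't a GRing.unit;
  dvr_factor : forall x : dvr_ring, x != 0 ->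
    exists2 u : dvr_ring, u \is a GRing.unit & exists n, x = u * uniformizer ^+ n;
  residue_map_surj : forall c, exists r, residue_map r = c;
  residue_map_ker : forall r, residue_map r = 0 <-> exists s, r = uniformizer * s
}.

Section Lattices.

Variables (R : dvr) (d : nat).

Local Notation K := {fraction R}.
Local Notation V := 'rV[K]_d.
Local Notation pi := (uniformizer R).
Local Notation kappa := (residue_field R).
Local Notation res := (residue_map R).

Definition tofracR (r : R) : K := tofrac r.
HB.instance Definition _ := GRing.RMorphism.copy tofracR (@tofrac R).
Local Notation "r %:F" := (tofracR r).

Definition piK : K := pi%:F.

Definition row_lattice (B : 'M[K]_d) : set V :=
  [set map_mx tofracR c *m B | c in [set: 'rV[R]_d]].

(* The rows of B are an R-basis of L and a K-basis of K^d.  *)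
Definition is_lattice (L : set V) : Prop :=
  exists2 B : 'M[K]_d, B \in unitmx & L = row_lattice B.

Record lattice := Lattice { lat_set :> set V; latticeP : is_lattice lat_set }.

Definition homothetic (L1 L2 : set V) : Prop :=
  exists2 a : K, a != 0 & L2 = [set a *: x | x in L1].

Definition lat_basis (L : lattice) : 'M[K]_d := s2val (cid2 (latticeP L)).

Lemma lat_basis_unit L : lat_basis L \in unitmx.
Proof. exact: (s2valP (cid2 (latticeP L))). Qed.

Lemma lat_basisE (L : lattice) : lat_set L = row_lattice (lat_basis L).
Proof. exact: (s2valP' (cid2 (latticeP L))). Qed.

Lemma latP (L : lattice) x :
  lat_set L x <-> exists c : 'rV[R]_d, x = map_mx tofracR c *m lat_basis L.
Proof.
rewrite lat_basisE; split=> [[c _ <-]|[c ->]]; first by exists c.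
by exists c.
Qed.

Definition lat_pred (L : lattice) : pred V := fun x => `[< lat_set L x >].

Lemma lat_predP L x : reflect (lat_set L x) (x \in lat_pred L).
Proof. exact: asboolP. Qed.

Lemma lat_scale_closed (L : lattice) (r : R) x : lat_set L x -> lat_set L (r%:F *: x).
Proof.
case/latP=> c ->; apply/latP; exists (r *: c).
by rewrite map_mxZ scalemxAl.
Qed.

Lemma lat_zmod_closed L : zmod_closed (lat_pred L).
Proof.
split=> [|x y /lat_predP/latP[c ->] /lat_predP/latP[c' ->]]; apply/lat_predP/latP.
  by exists 0; rewrite map_mx0 mul0mx.
by exists (c - c'); rewrite map_mxB mulmxBl.
Qed.

HB.instance Definition _ L := GRing.isZmodClosed.Build V (lat_pred L)
  (lat_zmod_closed L).

Record lat_elt (L : lattice) := LatElt { lat_val :> V; _ : lat_val \in lat_pred L }.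

HB.instance Definition _ L := [isSub for @lat_val L].
HB.instance Definition _ L := [Choice of lat_elt L by <:].
HB.instance Definition _ L := [SubChoice_isSubZmodule of lat_elt L by <:].

Section Scale.
Variable L : lattice.

Fact lat_scale_subproof (r : R) (x : lat_elt L) : r%:F *: val x \in lat_pred L.
Proof. by apply/lat_predP/lat_scale_closed/lat_predP; case: x. Qed.

Definition lat_scale (r : R) (x : lat_elt L) : lat_elt L :=
  LatElt (lat_scale_subproof r x).

Fact lat_scaleA a b v : lat_scale a (lat_scale b v) = lat_scale (a * b) v.
Proof. by apply: val_inj; rewrite /= scalerA rmorphM. Qed.
Fact lat_scale1 : left_id 1 lat_scale.
Proof. by move=> v; apply: val_inj; rewrite /= rmorph1 scale1r. Qed.
Fact lat_scaleDr : right_distributive lat_scale +%R.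
Proof. by move=> a u v; apply: val_inj; exact: scalerDr. Qed.
Fact lat_scaleDl v : {morph lat_scale^~ v : a b / a + b}.
Proof. by move=> a b; apply: val_inj; rewrite [LHS]/= rmorphD; exact: scalerDl. Qed.

HB.instance Definition _ := GRing.Zmodule_isLmodule.Build R (lat_elt L)
  lat_scaleA lat_scale1 lat_scaleDr lat_scaleDl.

Definition lat_pi : pred (lat_elt L) := fun x => `[< exists y, x = pi *: y >].

Lemma lat_pi_zmod_closed : zmod_closed lat_pi.
Proof.
split=> [|x y /asboolP[x' ->] /asboolP[y' ->]]; apply/asboolP.
  by exists 0; rewrite scaler0.
by exists (x' - y'); rewrite scalerBr.
Qed.

HB.instance Definition _ := GRing.isZmodClosed.Build (lat_elt L) lat_pi
  lat_pi_zmod_closed.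

(* L / pi L; the notation only asks for an additive subgroup, not a ring ideal. *)
Definition lat_piZ : zmodClosed (lat_elt L) := GRing.ZmodClosed.clone _ lat_pi _.

Definition lat_red := {ideal_quot lat_piZ}.
HB.instance Definition _ := EqQuotient.on lat_red.
HB.instance Definition _ := GRing.Zmodule.on lat_red.

Definition to_red (x : lat_elt L) : lat_red := \pi_{ideal_quot lat_piZ} x.

Lemma to_red_eq x y : to_red x = to_red y <-> exists z, x - y = pi *: z.
Proof.
rewrite /to_red; split=> [/eqP|h].
  by rewrite -Quotient.idealrBE => /asboolP.
by apply/eqP; rewrite -Quotient.idealrBE; apply/asboolP.
Qed.

Lemma to_red_repr (q : lat_red) : to_red (repr q) = q.
Proof. exact: reprK. Qed.

Lemma to_red_surj (q : lat_red) : exists x, q = to_red x.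
Proof. by exists (repr q); rewrite to_red_repr. Qed.

Lemma to_redD x y : to_red (x + y) = to_red x + to_red y.
Proof. exact: (raddfD \pi_{ideal_quot lat_piZ}). Qed.

Lemma to_red0 : to_red 0 = 0.
Proof. exact: (raddf0 \pi_{ideal_quot lat_piZ}). Qed.

Definition res_lift (c : kappa) : R := sval (cid (residue_map_surj c)).

Lemma res_liftK c : res (res_lift c) = c.
Proof. exact: (svalP (cid (residue_map_surj c))). Qed.

Lemma res_eq (r s : R) : res r = res s -> exists t, r - s = pi * t.
Proof. by move=> e; apply/residue_map_ker; rewrite rmorphB e subrr. Qed.

Definition red_scale (c : kappa) (q : lat_red) : lat_red :=
  to_red (res_lift c *: repr q).

Lemma red_scaleE r x : red_scale (res r) (to_red x) = to_red (r *: x).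
Proof.
apply/to_red_eq.
have [t et] := res_eq (res_liftK (res r)).
have [z ez] := (to_red_eq _ _).1 (to_red_repr (to_red x)).
exists (res_lift (res r) *: z + t *: x).
have -> : pi *: (res_lift (res r) *: z + t *: x)
    = res_lift (res r) *: (pi *: z) + (pi * t) *: x.
  by rewrite scalerDr !scalerA [pi * res_lift _]mulrC.
by rewrite -ez -et scalerBr scalerBl addrA subrK.
Qed.

Fact red_scaleA a b v : red_scale a (red_scale b v) = red_scale (a * b) v.
Proof.
have [x ->] := to_red_surj v; rewrite -(res_liftK a) -(res_liftK b) -rmorphM.
by rewrite !red_scaleE scalerA.
Qed.
Fact red_scale1 : left_id 1 red_scale.
Proof.
move=> v; have [x ->] := to_red_surj v.
by rewrite -(rmorph1 res) red_scaleE scale1r.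
Qed.
Fact red_scaleDr : right_distributive red_scale +%R.
Proof.
move=> a u v; have [x ->] := to_red_surj u; have [y ->] := to_red_surj v.
by rewrite -(res_liftK a) -to_redD !red_scaleE scalerDr to_redD.
Qed.
Fact red_scaleDl v : {morph red_scale^~ v : a b / a + b}.
Proof.
move=> a b; have [x ->] := to_red_surj v; rewrite -(res_liftK a) -(res_liftK b).
by rewrite -rmorphD !red_scaleE scalerDl to_redD.
Qed.

HB.instance Definition _ := GRing.Zmodule_isLmodule.Build kappa lat_red
  red_scaleA red_scale1 red_scaleDr red_scaleDl.

Lemma to_redZ r x : to_red (r *: x) = res r *: to_red x.
Proof. by rewrite -red_scaleE. Qed.

Lemma lat_coord_ex (x : lat_elt L) :
  exists c : 'rV[R]_d, lat_val x = map_mx tofracR c *m lat_basis L.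
Proof. by apply/latP/lat_predP; case: x. Qed.

Definition lat_coord (x : lat_elt L) : 'rV[R]_d := sval (cid (lat_coord_ex x)).

Lemma lat_coordE x : lat_val x = map_mx tofracR (lat_coord x) *m lat_basis L.
Proof. exact: (svalP (cid (lat_coord_ex x))). Qed.

Lemma tofracR_inj : injective tofracR.
Proof. by move=> x y /eqP; rewrite tofrac_eq => /eqP. Qed.

Lemma lat_coord_uniq x c :
  lat_val x = map_mx tofracR c *m lat_basis L -> lat_coord x = c.
Proof.
rewrite lat_coordE => /(congr1 (mulmx^~ (invmx (lat_basis L)))).
rewrite !mulmxK ?lat_basis_unit // => e.
apply/matrixP=> i j; apply: tofracR_inj.
by have /matrixP/(_ i j) := e; rewrite !mxE.
Qed.

Lemma lat_coord_lin r x y : lat_coord (r *: x + y) = r *: lat_coord x + lat_coord y.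
Proof.
apply: lat_coord_uniq; rewrite [LHS]/= !lat_coordE.
by rewrite map_mxD map_mxZ mulmxDl scalemxAl.
Qed.

Definition red_coord (q : lat_red) : 'rV[kappa]_d := map_mx res (lat_coord (repr q)).

Lemma red_coordE x : red_coord (to_red x) = map_mx res (lat_coord x).
Proof.
have [z ez] := (to_red_eq _ _).1 (to_red_repr (to_red x)).
rewrite /red_coord -[repr _](subrK x) ez lat_coord_lin map_mxD map_mxZ.
have -> : res pi = 0 by apply/residue_map_ker; exists 1; rewrite mulr1.
by rewrite scale0r add0r.
Qed.

Fact red_vector_axiom : Vector.axiom d lat_red.
Proof.
exists red_coord.
  move=> a u v; have [x ->] := to_red_surj u; have [y ->] := to_red_surj v.
  rewrite -(res_liftK a) -to_redZ -to_redD !red_coordE lat_coord_lin.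
  by rewrite map_mxD map_mxZ.
have mem (c : 'rV[R]_d) : map_mx tofracR c *m lat_basis L \in lat_pred L.
  by apply/lat_predP/latP; exists c.
have memE c : lat_coord (LatElt (mem c)) = c by exact: lat_coord_uniq.
pose g (c : 'rV[kappa]_d) := to_red (LatElt (mem (\row_j res_lift (c 0 j)))).
have gK : cancel g red_coord.
  move=> c; rewrite red_coordE memE; apply/rowP=> j.
  by rewrite !mxE res_liftK.
exists g => // q; have [x ->] := to_red_surj q; apply/to_red_eq.
set c := \row_j _.
have ex j : exists t, c 0 j - lat_coord x 0 j = pi * t.
  by apply: res_eq; rewrite /c mxE res_liftK red_coordE mxE.
have [t et] := choice ex.
exists (LatElt (mem (\row_j t j))); apply: val_inj; rewrite /= lat_coordE.
rewrite -mulmxBl -map_mxB scalemxAl -map_mxZ; congr (map_mx _ _ *m _).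
by apply/rowP=> j; rewrite 2![in RHS]mxE -et [LHS]mxE [X in _ + X]mxE.
Qed.

HB.instance Definition _ := Lmodule_hasFinDim.Build kappa lat_red red_vector_axiom.

End Scale.

(* The minimal n with pi^n L1 included in L2; [xget] falls back to 0 when there *)
(* is no minimum, which happens only for d = 0.                                 *)
Definition lat_index (L1 L2 : lattice) : int :=
  xget 0 [set n : int |
    (forall x, lat_set L1 x -> lat_set L2 (piK ^ n *: x)) /\
    (forall m : int, (forall x, lat_set L1 x -> lat_set L2 (piK ^ m *: x)) -> n <= m)].

Lemma fracE_ex (a : K) : exists r s : R, s != 0 /\ a = r%:F / s%:F.
Proof.
elim/quotW: a => x; exists (frac x).1, (frac x).2; split; first exact: denom_ratioP.
have nz : (frac x).2%:F != 0 by rewrite tofrac_eq0 denom_ratioP.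
apply: (canRL (mulfK nz)); rewrite /tofracR.
rewrite /tofrac; unlock FracField.tofrac.
rewrite [LHS]piE; apply/eqP.
apply: (etrans (FracField.equivf_def _ _)); rewrite /=.
have y0 := denom_ratioP x; have z0 := oner_neq0 R.
rewrite /FracField.mulf !(numer_Ratio, denom_Ratio) ?mulf_neq0 // !mulr1.
by rewrite [X in X == _]mulrC eqxx.
Qed.

Lemma piK_neq0 : piK != 0.
Proof. by rewrite /piK tofrac_eq0 uniformizer_neq0. Qed.

Lemma piK_clear (a : K) : exists n r, piK ^+ n * a = r%:F.
Proof.
have [r [s [s0 ->]]] := fracE_ex a.
have [u uU [n es]] := dvr_factor s0; exists n, (r * u^-1).
have uF : u%:F != 0 by rewrite tofrac_eq0; apply: contraTneq uU => ->; rewrite unitr0.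
have pn : piK ^+ n != 0 by rewrite expf_neq0 ?piK_neq0.
have inv : (u^-1)%:F = u%:F^-1.
  by apply: (mulfI uF); rewrite mulfV // -rmorphM divrr // rmorph1.
by rewrite es !rmorphM rmorphXn -/piK /= inv invfM mulrCA [_^-1 * _^-1]mulrC mulVKf.
Qed.

Lemma piK_clear_mx m n (A : 'M[K]_(m, n)) :
  exists k C, piK ^+ k *: A = map_mx tofracR C.
Proof.
pose N i j := sval (cid (piK_clear (A i j))).
have hN i j : exists r, piK ^+ N i j * A i j = r%:F := svalP (cid (piK_clear (A i j))).
pose k := \max_i \max_j N i j; exists k.
have ex i j : exists r, piK ^+ k * A i j = r%:F.
  have [r e] := hN i j; exists (pi ^+ (k - N i j) * r).
  rewrite rmorphM rmorphXn /= -e mulrA -/piK -exprD subnK //.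
  by rewrite (leq_trans (leq_bigmax j)) // (leq_bigmax (F := fun i => \max_j N i j) i).
exists (\matrix_(i, j) sval (cid (ex i j))); apply/matrixP=> i j.
rewrite !mxE; exact: svalP (cid (ex i j)).
Qed.

Lemma lat_index_ex (L1 L2 : lattice) :
  exists n : nat, forall x, lat_set L1 x -> lat_set L2 (piK ^ n *: x).
Proof.
have [n [C eC]] := piK_clear_mx (lat_basis L1 *m invmx (lat_basis L2)).
exists n => x /latP[c ->]; apply/latP; exists (c *m C).
rewrite map_mxM -eC -scalemxAr -scalemxAl mulmxA mulmxKV ?lat_basis_unit //.
Qed.

Lemma lat_index_ge0 (L : lattice) (m : int) : (0 < d)%N ->
  (forall x, lat_set L x -> lat_set L (piK ^ m *: x)) -> 0 <= m.
Proof.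
move=> d0 h; case: m h => // n h; exfalso.
pose j := Ordinal d0.
have /h/latP[c e] : lat_set L (map_mx tofracR (delta_mx 0 j) *m lat_basis L).
  by apply/latP; exists (delta_mx 0 j).
move/(congr1 (mulmx^~ (invmx (lat_basis L)))): e.
rewrite -scalemxAl !mulmxK ?lat_basis_unit // => /rowP/(_ j).
rewrite !mxE !eqxx rmorph1 mulr1 NegzE => e.
have pn : piK ^+ n.+1 != 0 by rewrite expf_neq0 ?piK_neq0.
have : pi * (pi ^+ n * c 0 j) = 1.
  apply: tofracR_inj; rewrite mulrA -exprS rmorphM rmorphXn rmorph1 /= -e.
  by rewrite -exprnN mulfV.
move/eqP; rewrite eq_sym => /eqP e1.
have /negP[] := uniformizer_nonunit R; apply/unitrPr.
by exists (pi ^+ n * c 0 j).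
Qed.

Lemma lat_indexP (L1 L2 : lattice) : (0 < d)%N ->
  (forall x, lat_set L1 x -> lat_set L2 (piK ^ lat_index L1 L2 *: x)) /\
  (forall m : int, (forall x, lat_set L1 x -> lat_set L2 (piK ^ m *: x)) ->
     lat_index L1 L2 <= m).
Proof.
move=> d0.
have [n0 h0] := lat_index_ex L1 L2; have [k hk] := lat_index_ex L2 L1.
pose S (n : int) := forall x, lat_set L1 x -> lat_set L2 (piK ^ n *: x).
have Sb n : S n -> - k%:Z <= n.
  move=> hn; rewrite -subr_ge0 opprK; apply: (@lat_index_ge0 L2) => // x /hk/hn.
  by rewrite scalerA -expfzDr ?piK_neq0.
have ex : exists m : nat, `[< S (m%:Z - k%:Z) >].
  by exists (n0 + k)%N; apply/asboolP; rewrite PoszD addrK.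
have [m /asboolP Sm mmin] := ex_minnP ex.
rewrite /lat_index; case: xgetP => [n -> //|/(_ (m%:Z - k%:Z))[]].
split=> // n Sn; have := Sb n Sn; rewrite -subr_ge0 opprK => nk0.
have := mmin `|(n + k%:Z)%R|%N; rewrite gez0_abs // addrK => /(_ (asboolT Sn)).
by rewrite lerBlDr -lez_nat gez0_abs.
Qed.

Lemma lat_index_sub (L1 L2 : lattice) x :
  lat_set L1 x -> lat_set L2 (piK ^ lat_index L1 L2 *: x).
Proof.
have [d0|/(lat_indexP L1 L2)[h _]] := posnP d; last exact: h.
by move=> _; apply/latP; exists 0; apply/rowP=> j; have := ltn_ord j; rewrite {2}d0.
Qed.

Section ReductionMap.
Variables L1 L2 : lattice.

Fact lat_mul_subproof (x : lat_elt L1) :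
  piK ^ lat_index L1 L2 *: val x \in lat_pred L2.
Proof. by apply/lat_predP/lat_index_sub/lat_predP; case: x. Qed.

Definition lat_mul (x : lat_elt L1) : lat_elt L2 := LatElt (lat_mul_subproof x).

Lemma lat_mul_lin r x y : lat_mul (r *: x + y) = r *: lat_mul x + lat_mul y.
Proof.
apply: val_inj; rewrite [LHS]/= [RHS]/= [LHS]scalerDr.
by congr (_ + _); rewrite !scalerA mulrC.
Qed.

Definition red_map_fun (q : lat_red L1) : lat_red L2 := to_red (lat_mul (repr q)).

Lemma red_map_funE x : red_map_fun (to_red x) = to_red (lat_mul x).
Proof.
have [z ez] := (to_red_eq _ _).1 (to_red_repr (to_red x)).
apply/to_red_eq; exists (lat_mul z).
by rewrite -[repr _](subrK x) ez lat_mul_lin addrK.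
Qed.

Fact red_map_fun_linear : linear red_map_fun.
Proof.
move=> a u v; have [x ->] := to_red_surj u; have [y ->] := to_red_surj v.
rewrite -(res_liftK a) -to_redZ -to_redD !red_map_funE lat_mul_lin.
by rewrite to_redD to_redZ.
Qed.

HB.instance Definition _ :=
  GRing.isLinear.Build kappa (lat_red L1) (lat_red L2) _ red_map_fun
    red_map_fun_linear.

Definition red_map : 'Hom(lat_red L1, lat_red L2) := linfun red_map_fun.

Lemma red_mapE x : red_map (to_red x) = to_red (lat_mul x).
Proof. by rewrite lfunE /= red_map_funE. Qed.

End ReductionMap.

End Lattices.

Section QuiverRepresentations.

Variables (k : fieldType) (T : Type) (Q : rel T).

Inductive qpath : T -> T -> Type :=
| QNil u : qpath u u
| QCons u w v : Q u w -> qpath w v -> qpath u v.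

Fixpoint qlength u v (p : qpath u v) : nat :=
  if p is QCons _ _ _ _ p' then (qlength p').+1 else 0%N.

Record qrep := QRep {
  qspace :> T -> lmodType k;
  qmap : forall u v, Q u v -> {linear qspace u -> qspace v}
}.

Fixpoint qcomp (M : qrep) u v (p : qpath u v) : M u -> M v :=
  match p in qpath u v return M u -> M v with
  | QNil _ => id
  | QCons _ _ _ a p' => fun x => qcomp p' (qmap M a x)
  end.

Record qhom (M N : qrep) := QHom {
  qhom_map : forall v, {linear M v -> N v};
  qhom_comm : forall u v (a : Q u v) x,
    qhom_map v (qmap M a x) = qmap N a (qhom_map u x)
}.

(* N is a module over the path algebra of Q modulo the relations satisfied by M *)
Definition satisfies_relations_of (M N : qrep) : Prop :=
  (forall u v (p : qpath u v),
     (forall x, qcomp (M := M) p x = 0) -> forall y, qcomp (M := N) p y = 0) /\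
  (forall u v (p q : qpath u v),
     (forall x, qcomp (M := M) p x = qcomp (M := M) q x) ->
     forall y, qcomp (M := N) p y = qcomp (M := N) q y).

(* M is a projective module over the path algebra of Q modulo its own relations *)
Definition qprojective (M : qrep) : Prop :=
  forall N N' : qrep,
    satisfies_relations_of M N -> satisfies_relations_of M N' ->
  forall g : qhom N N', (forall v y, exists x, qhom_map g v x = y) ->
  forall h : qhom M N',
  exists h' : qhom M N, forall v x, qhom_map g v (qhom_map h' v x) = qhom_map h v x.

End QuiverRepresentations.

Section Configurations.

(* The configuration is the set of classes of the L v.  *)
Variables (R : dvr) (d : nat) (Gamma : finType) (L : Gamma -> lattice R d).

Local Notation K := {fraction R}.
Local Notation kappa := (residue_field R).
Local Notation Lbar v := (lat_red (L v)).
Local Notation f u v := (red_map (L u) (L v)).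

Definition convex_config : Prop :=
  [/\ (0 < #|Gamma|)%N,
      forall u v, homothetic (L u) (L v) -> u = v
    & forall u v (a b : K), a != 0 -> b != 0 ->
        exists w, homothetic (L w)
          ([set a *: x | x in (L u : set 'rV[K]_d)] `&`
           [set b *: x | x in (L v : set 'rV[K]_d)])].

Definition factors_through (u v w : Gamma) : Prop := f u v = (f w v \o f u w)%VF.

Definition locally_weakly_independent_at (v : Gamma) : Prop :=
  exists I : {set Gamma},
  [/\ v \notin I,
      forall u, u != v -> exists2 w, w \in I & factors_through u v w
    & directv (\sum_(w in I) limg (f w v))].

Definition locally_weakly_independent : Prop :=
  forall v, locally_weakly_independent_at v.

Definition reduction_rep (Q : rel Gamma) : qrep kappa Q :=
  @QRep kappa Gamma Q (fun v => Lbar v) (fun u v _ => f u v).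

Definition full_quiver : rel Gamma := fun u v => u != v.

Definition config_quiver : rel Gamma := fun u v =>
  (u != v) && `[< ~ exists2 p : qpath full_quiver u v, (2 <= qlength p)%N &
                  forall x, qcomp (M := reduction_rep full_quiver) p x = f u v x >].

Definition config_rep : qrep kappa config_quiver := reduction_rep config_quiver.

Definition is_subrep (N : forall v, {vspace Lbar v}) : Prop :=
  forall u v, config_quiver u v -> (f u v @: N u <= N v)%VS.

(* N is the smallest sub-representation containing x in degree v *)
Definition generated_by (N : forall v, {vspace Lbar v}) v (x : Lbar v) : Prop :=
  [/\ is_subrep N, x \in N v
    & forall N', is_subrep N' -> x \in N' v -> forall w, (N w <= N' w)%VS].

Definition is_direct_sum (N : forall v, {vspace Lbar v}) (n : nat)
    (S : 'I_n -> forall v, {vspace Lbar v}) : Prop :=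
  forall v, directv (\sum_i S i v) /\ N v = (\sum_i S i v)%VS.

Definition in_apartment : Prop :=
  exists2 E : 'M[K]_d, E \in unitmx &
    forall v, exists c : 'I_d -> int,
      homothetic (L v) (row_lattice (\matrix_i (piK R ^ c i *: row i E))).

End Configurations.

(* Main.v *)
(* Let f_{u,v} be the reduction maps. Composites f_{w,v} f_{u,w} are f_{u,v} or   *)
(* 0, and convexity shows that each kernel ker f_{v,u} (u != v) is an image       *)
(* Im f_{w,v} with w adjacent to v. Weak independence at the target makes the     *)
(* vertices through which f_{u,v} factors a chain; hence every kernel at v lies   *)
(* in one of the independent subspaces K_z = Im f_{z,v}, z in I_v, and the        *)
(* kernels inside the same K_z form a flag.                                      *)
(*                                                                            *)
(* For a sub-representation N, the radical of N at v is the (direct) sum of the   *)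
(* f_{z,v}(N_z), z in I_v. One can therefore choose generators of N_v modulo the  *)
(* radical that are adapted to all kernels at v, and by induction along the       *)
(* chains their nonzero images form a basis of each N_w. For N = M the kernels at *)
(* v lie in the radical, so no generator is killed: M is projective, and lifting *)
(* the generators to the lattices gives, by Nakayama, a basis of K^d adapted to   *)
(* all of them.                                                                *)

(* The integers [lat_index] satisfy a triangle inequality. When it is an equality, a composite of
   two reduction maps is again a reduction map; otherwise an extra factor of the uniformizer makes
   it zero ([red_map_comp], [red_map_between]). Together with [convex_ker], this is all that the
   decomposition uses about lattices, and it is axiomatised as [reduction_system].

   Weak independence enters through [between_chain] and [ker_comparable]: the kernels at a vertex
   form flags inside independent subspaces. So [adapted_generators] provides generators of a
   sub-representation modulo its radical that split every kernel. By [generators_span] and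
   [generators_independent], their nonzero images are bases at all vertices, which is
   [subrep_decomposition]. For the whole representation no image vanishes ([projective_basis]).
   Transporting lifts of the generators along paths gives projectivity, and lifting them to vectors
   of the lattices gives the apartment. *)
From HB Require Import structures.
Require Import Defs.
From mathcomp Require Import all_boot all_order all_algebra.
From mathcomp Require Import zify boolp classical_sets.

Set Implicit Arguments.
Unset Strict Implicit.
Unset Printing Implicit Defensive.

Import GRing.Theory Num.Theory Order.TTheory.
Local Open Scope ring_scope.

(** * Generators adapted to flags in independent subspaces *)

Section AdaptedGenerators.

Variables (k : fieldType) (W : vectType k) (I J : finType).
Variables (P : pred I) (K : I -> {vspace W}) (Q : pred J) (F : J -> {vspace W}).
Variable W0 : {vspace W}.

Hypothesis F_sub : forall j, Q j -> exists2 i, P i & (F j <= K i)%VS.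
Hypothesis F_chain : forall i j j', P i -> Q j -> Q j' ->
  (F j <= K i)%VS -> (F j' <= K i)%VS -> (F j <= F j')%VS \/ (F j' <= F j)%VS.

(** Equivalently, the images of the [K i] in the quotient of [W] by [A] are independent. *)
Definition graded (A : {vspace W}) :=
  forall kk : I -> W, (forall i, P i -> kk i \in K i) ->
    \sum_(i | P i) kk i \in A -> forall i, P i -> kk i \in A.

(** Modulo [A], the part of [U] inside [A + <<X>>] is spanned by the members of [X] that lie in [U].
    For [U = 0] and nonzero members this is linear independence modulo [A]. *)
Definition splits (U A : {vspace W}) (X : seq W) :=
  forall (a : nat -> k) n, n \in A -> n + \sum_(i < size X) a i *: X`_i \in U ->
    forall i, (i < size X)%N -> a i *: X`_i \in U.

Lemma splits_cons (U A : {vspace W}) x X :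
    (forall a n, n \in A -> n + a *: x \in U -> a *: x \in U) ->
    splits U (A + <[x]>)%VS X -> splits U A (x :: X).
Proof.
move=> Ux UX a n nA; rewrite big_ord_recl /= addrA => nU.
have UX' i : (i < size X)%N -> a i.+1 *: X`_i \in U.
  apply: (UX (fun i => a i.+1) (n + a 0%N *: x)) => //.
  by rewrite memv_add // memvZ ?memv_line.
case=> [_|i]; last exact: UX'.
apply: Ux nA _; move: nU; rewrite rpredDr //.
by apply: rpred_sum => i _; apply: UX'.
Qed.

Lemma graded_add (A : {vspace W}) i x : P i -> x \in K i -> graded A -> graded (A + <[x]>)%VS.
Proof.
move=> Pi xK grA kk kkK /memv_addP[n nA [_ /vlineP[a ->] e]].
pose kk' j := kk j - (if j == i then a *: x else 0).
have kk'K j : P j -> kk' j \in K j.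
  by move=> Pj; rewrite /kk' rpredB ?kkK //; case: eqP => [->|_]; rewrite ?memvZ ?mem0v.
have kk'A : \sum_(j | P j) kk' j \in A.
  rewrite sumrB e (bigD1 i) //= eqxx big1 ?addr0 ?addrK //.
  by move=> j /andP[_ /negPf ->].
move=> j Pj; rewrite -[kk j](subrK (if j == i then a *: x else 0)).
apply: memv_add; first exact: grA kk'A j Pj.
by case: eqP => _; rewrite ?mem0v ?memvZ ?memv_line.
Qed.

(* The vector is taken in an [F j] that is minimal among those whose trace on   *)
(* [W0] is not contained in [A].                                               *)
Lemma next_generator (A : {vspace W}) : (A <= W0)%VS -> ~~ (W0 <= A)%VS ->
    (forall j, Q j -> (F j :&: W0 <= A)%VS) \/ graded A ->
  exists x, [/\ x \in W0, x \notin A,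
    forall j, Q j -> forall a n, n \in A -> n + a *: x \in F j -> a *: x \in F j
  & (forall j, Q j -> (F j :&: W0 <= A + <[x]>)%VS) \/ graded (A + <[x]>)%VS].
Proof.
move=> AW0 W0A invA.
pose C j := Q j && ~~ (F j :&: W0 <= A)%VS.
(* Once [A] contains all traces, any new vector [x] works: [n + a *: x] in [F j] would lie in [A],
   forcing [a = 0]. *)
have [j0 Cj0|C0] := pickP C; last first.
  have FA j (Qj : Q j) : (F j :&: W0 <= A)%VS.
    by move: (C0 j); rewrite /C Qj => /negbFE.
  have [x xW xA] := subvPn W0A; exists x; split=> //.
    move=> j Qj a n nA h; have /(subvP (FA j Qj)) : n + a *: x \in (F j :&: W0)%VS.
      by rewrite memv_cap h rpredD ?memvZ // (subvP AW0).
    rewrite rpredDl //; have [->|a0] := eqVneq a 0; first by rewrite scale0r !mem0v.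
    by rewrite rpredZeq (negPf a0) (negPf xA).
  by left=> j Qj; apply: subv_trans (FA j Qj) _; apply: addvSl.
case: invA => [FA|grA]; first by case/andP: Cj0 => /FA ->.
case: (arg_minnP (fun j => \dim (F j :&: W0)) Cj0) => j /andP[Qj FjA] jmin.
have [x /memv_capP[xF xW] xA] := subvPn FjA.
have [i Pi Fji] := F_sub Qj; have xK := subvP Fji _ xF.
exists x; split=> //; last by right; exact: graded_add Pi xK grA.
move=> j' Qj' a n nA nF.
have [->|a0] := eqVneq a 0; first by rewrite scale0r mem0v.
set y := n + a *: x in nF.
have axA : a *: x \notin A by rewrite rpredZeq (negPf a0).
have yA : y \notin A by rewrite rpredDl.
have yW : y \in W0 by rewrite rpredD ?memvZ // (subvP AW0).
have Fj'A : ~~ (F j' :&: W0 <= A)%VS.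
  by apply: contra yA => /subvP; apply; rewrite memv_cap nF.
have [i' Pi' Fji'] := F_sub Qj'; have yK := subvP Fji' _ nF.
(* Inside one [K i] the two spaces are nested, and minimality of the trace of [F j] excludes a
   strictly smaller trace for [F j']. *)
have [eii'|nii'] := eqVneq i i'.
  subst i'; apply: memvZ.
  have [/subvP|Fj'j] := F_chain Pi Qj Qj' Fji Fji'; first exact.
  have eF : (F j' :&: W0 = F j :&: W0)%VS.
    apply/eqP; rewrite eqEdim capvS //=; apply: jmin.
    by rewrite /C Qj'.
  suff : x \in (F j' :&: W0)%VS by rewrite memv_cap => /andP[].
  by rewrite eF memv_cap xF.
(* For different indices, [n = y - a *: x] is a sum of components in [K i'] and [K i]; gradedness
   would put [a *: x] in [A]. *)
pose kk l := if l == i then - (a *: x) else if l == i' then y else 0.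
case/negP: axA; rewrite -rpredN.
have <- : kk i = - (a *: x) by rewrite /kk eqxx.
apply: grA => // [l Pl|].
  rewrite /kk; case: eqP => [->|_]; first by rewrite rpredN memvZ.
  by case: eqP => [->|_] //; rewrite mem0v.
rewrite (bigD1 i) //= (bigD1 i') /= 1?eq_sym ?nii' ?Pi' //.
rewrite big1 => [|l /andP[/andP[_ li] li']]; last by rewrite /kk (negPf li) (negPf li').
by rewrite /kk eqxx eq_sym (negPf nii') eqxx addr0 /y addrC addrK.
Qed.

Lemma adapted_generators (A : {vspace W}) : (A <= W0)%VS -> graded A ->
  exists X : seq W,
    [/\ {subset X <= W0}, (W0 <= A + <<X>>)%VS, forall x, x \in X -> x \notin A,
        splits 0%VS A X & forall j, Q j -> splits (F j) A X].
Proof.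
(* The disjunction is the invariant of the induction on codimension: gradedness is kept while some
   trace is outside [A], and may be lost once arbitrary vectors are added. *)
move=> AW0 grA; have {grA} : (forall j, Q j -> (F j :&: W0 <= A)%VS) \/ graded A by right.
elim: {A}_.+1 {-2}A (ltnSn (\dim W0 - \dim A)) AW0 => // m IHm A mA AW0 invA.
have [W0A|W0A] := boolP (W0 <= A)%VS.
  by exists [::]; split=> //; rewrite span_nil addv0.
have [x [xW xA Fx inv']] := next_generator AW0 W0A invA.
have A'W0 : (A + <[x]> <= W0)%VS by rewrite subv_add AW0 -memvE.
have AA' : (\dim A < \dim (A + <[x]>))%N.
  rewrite (ltn_leqif (dimv_leqif_sup (addvSl A <[x]>))) subv_add subvv /=.
  by rewrite -memvE.
have mA' : (\dim W0 - \dim (A + <[x]>) < m)%N.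
  rewrite ltnS in mA; apply: leq_trans mA; apply: ltn_sub2l => //.
  exact: leq_trans AA' (dimvS A'W0).
have [X [XW W0X XA X0 XF]] := IHm _ mA' A'W0 inv'.
exists (x :: X); split.
- by move=> y; rewrite inE => /predU1P[->|/XW].
- by rewrite span_cons addvA.
- move=> y; rewrite inE => /predU1P[->//|/XA]; apply: contra.
  by apply/subvP/addvSl.
- apply: splits_cons X0 => a n nA; rewrite !memv0 => /eqP e.
  have [->|a0] := eqVneq a 0; first by rewrite scale0r.
  by case/negP: xA; have := nA; rewrite -rpredN -(addr0 (- n)) -e addKr rpredZeq (negPf a0).
by move=> j Qj; apply: splits_cons (XF j Qj); exact: Fx.
Qed.

End AdaptedGenerators.

(** * Weakly independent systems of reduction maps *)

Section IndependentSystems.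

Variables (k : fieldType) (Gamma : finType) (V : Gamma -> vectType k).
Variable f : forall u v, 'Hom(V u, V v).

Definition between u w v := f u v == (f w v \o f u w)%VF.

(** The last clause of [redsys_ker] records that [w] is adjacent to [v]: a route from [w] to [v]
    through [z] makes [w] the first stop from [v] to [z]. *)
Record reduction_system : Prop := ReductionSystem {
  redsys_id : forall u, f u u = \1%VF;
  redsys_neq0 : forall u v, f u v != 0;
  redsys_comp : forall u w v, between u w v \/ (f w v \o f u w)%VF = 0;
  redsys_cycle : forall u v, u != v -> (f v u \o f u v)%VF = 0;
  redsys_ker : forall u v, u != v -> exists w,
    [/\ w != v, lker (f v u) = limg (f w v)
      & forall z, z != v -> between w z v -> between v w z]
}.

Record independent_system (I : Gamma -> {set Gamma}) : Prop := IndependentSystem {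
  indsys_red :> reduction_system;
  indsys_notin : forall v, v \notin I v;
  indsys_factor : forall u v, u != v -> exists2 w, w \in I v & between u w v;
  indsys_direct : forall v, directv (\sum_(w in I v) limg (f w v))
}.

Lemma betweenE u w v x : between u w v -> f u v x = f w v (f u w x).
Proof. by move=> /eqP ->; rewrite comp_lfunE. Qed.

Section ReductionSystem.

Hypothesis Hf : reduction_system.

Lemma redsys_id_apply u x : f u u x = x.
Proof. by rewrite (redsys_id Hf) id_lfunE. Qed.

Lemma redsys_cycle_apply u v x : u != v -> f v u (f u v x) = 0.
Proof. by move=> uv; rewrite -comp_lfunE (redsys_cycle Hf) // lfunE. Qed.

Lemma redsys_comp_apply u w v :
  between u w v \/ forall x, f w v (f u w x) = 0.
Proof.
case: (redsys_comp Hf u w v) => [|e]; first by left.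
by right=> x; rewrite -comp_lfunE e lfunE.
Qed.

Lemma redsys_neq0_apply u v : exists x, f u v x != 0.
Proof.
apply/not_existsP => h; case/eqP: (redsys_neq0 Hf u v).
by apply/lfunP=> x; rewrite lfunE; have /negP/negbNE/eqP := h x.
Qed.

Lemma between_nonzero u w v x :
  f w v (f u w x) != 0 -> between u w v.
Proof. by case: (redsys_comp_apply u w v) => // ->; rewrite eqxx. Qed.

Lemma between_l u v : between u u v.
Proof. by rewrite /between (redsys_id Hf) comp_lfun1r. Qed.

Lemma between_r u v : between u v v.
Proof. by rewrite /between (redsys_id Hf) comp_lfun1l. Qed.

(** A vector not killed by [f u v] survives every intermediate composite, so none of them is the
    zero alternative of [redsys_comp]. *)
Lemma between_left u w v z :
  between u w v -> between u z w -> between u z v /\ between z w v.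
Proof.
move=> uwv uzw; have [x nz] := redsys_neq0_apply u v.
have zwv : between z w v.
  apply: (@between_nonzero _ _ _ (f u z x)).
  by rewrite -(betweenE _ uzw) -(betweenE _ uwv).
split=> //; apply/eqP/lfunP=> y.
by rewrite comp_lfunE (betweenE _ uwv) (betweenE _ uzw) -(betweenE _ zwv).
Qed.

Lemma between_right u w v z :
  between u w v -> between w z v -> between u z v /\ between u w z.
Proof.
move=> uwv wzv; have [x nz] := redsys_neq0_apply u v.
have uwz : between u w z.
  apply/(between_nonzero (x := x))/negP => /eqP e; case/negP: nz.
  by rewrite (betweenE _ uwv) (betweenE _ wzv) e linear0.
split=> //; apply/eqP/lfunP=> y.
by rewrite comp_lfunE (betweenE _ uwv) (betweenE _ wzv) -(betweenE _ uwz).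
Qed.

Lemma between_antisym u w z : between u w z -> between u z w -> w = z.
Proof.
move=> uwz uzw; apply/eqP/negPn/negP=> wz.
have [x] := redsys_neq0_apply u w.
by rewrite (betweenE _ uzw) (betweenE _ uwz) redsys_cycle_apply ?eqxx.
Qed.

(** Its cardinality serves as the length of [f u v] in the inductions: it drops strictly when either
    endpoint moves to a proper intermediate vertex. *)
Definition factor_set u v : {set Gamma} := [set w | between u w v].

Lemma factor_set_ltl u w v : between u w v -> w != v ->
  (#|factor_set u w| < #|factor_set u v|)%N.
Proof.
move=> uwv wv; apply: proper_card; apply/properP; split.
  by apply/fintype.subsetP=> z; rewrite !inE => /(between_left uwv)[].
exists v; rewrite !inE ?between_r //; apply: contra wv => uvw.
by rewrite (between_antisym uwv uvw).
Qed.

Lemma factor_set_ltr u w v : between u w v -> u != w ->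
  (#|factor_set w v| < #|factor_set u v|)%N.
Proof.
move=> uwv uw; apply: proper_card; apply/properP; split.
  by apply/fintype.subsetP=> z; rewrite !inE => /(between_right uwv)[].
exists u; rewrite !inE ?between_l //; apply/negP=> wuv.
have [x] := redsys_neq0_apply u v.
by rewrite (betweenE _ uwv) (betweenE _ wuv) redsys_cycle_apply // linear0 eqxx.
Qed.

Lemma factor_set_gt0 u v : (0 < #|factor_set u v|)%N.
Proof. by apply/card_gt0P; exists u; rewrite inE between_l. Qed.

End ReductionSystem.

(** * Chains and flags of kernels under weak independence *)

Section IndependentSystem.

Variable I : Gamma -> {set Gamma}.
Hypothesis HI : independent_system I.

Let Hf : reduction_system := indsys_red HI.

Lemma indsys_neq z v : z \in I v -> z != v.
Proof. by apply: contraTneq => ->; apply: indsys_notin. Qed.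

Lemma between_limg u w v : between u w v -> (limg (f u v) <= limg (f w v))%VS.
Proof.
move=> uwv; apply/subvP=> _ /memv_imgP[x _ ->].
by rewrite (betweenE _ uwv) memv_img ?memvf.
Qed.

(** Subtracting the total from the component at [z] leaves a relation among independent subspaces,
    so every term vanishes. *)
Lemma direct_sum_mem v (A : {vspace V v}) kk z :
    z \in I v -> (forall w, w \in I v -> kk w \in limg (f w v)) ->
    (A <= limg (f z v))%VS -> \sum_(w in I v) kk w \in A ->
  kk z \in A /\ forall w, w \in I v -> w != z -> kk w = 0.
Proof.
move=> zI kkI Az sA.
have /directv_sum_independent dx := indsys_direct HI v.
pose kk' w := kk w - (if w == z then \sum_(w in I v) kk w else 0).
have s0 : \sum_(w in I v) kk' w = 0.
  rewrite sumrB [X in _ - X](bigD1 z) //= eqxx [X in _ - (_ + X)]big1 ?addr0 ?subrr //.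
  by move=> w /andP[_ /negPf ->].
have kk'0 w : w \in I v -> kk' w = 0.
  apply: dx s0 w => w wI; rewrite /kk' rpredB ?kkI //.
  by case: eqP => [->|_]; rewrite ?mem0v ?(subvP Az).
split=> [|w wI wz]; last by have := kk'0 w wI; rewrite /kk' (negPf wz) subr0.
by have /eqP := kk'0 z zI; rewrite /kk' eqxx subr_eq0 => /eqP ->.
Qed.

Lemma indep_eq v w z (x : V v) : w \in I v -> z \in I v -> x != 0 ->
  x \in limg (f w v) -> x \in limg (f z v) -> w = z.
Proof.
move=> wI zI x0 xw xz; apply/eqP/negPn/negP=> wz.
pose kk u := if u == w then x else 0.
have kkI u : u \in I v -> kk u \in limg (f u v).
  by move=> _; rewrite /kk; case: eqP => [->|_]; rewrite ?mem0v.
have s : \sum_(u in I v) kk u = x.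
  rewrite (bigD1 w) //= big1 ?addr0; first by rewrite /kk eqxx.
  by move=> u /andP[_ /negPf uw]; rewrite /kk uw.
have sz : \sum_(u in I v) kk u \in limg (f z v) by rewrite s.
have [_ /(_ w wI wz)] := direct_sum_mem zI kkI (subvv _) sz.
by rewrite /kk eqxx => /eqP; rewrite (negPf x0).
Qed.

(* Independence at the target forces all factorizations of [f u w] through one   *)
(* and the same element of [I w]; iterating this gives a unique maximal path.  *)
Lemma between_chain u w a b : between u a w -> between u b w ->
  between u a b /\ between a b w \/ between u b a /\ between b a w.
Proof.
elim: {u w}_.+1 {-2}u {-2}w (ltnSn #|factor_set u w|) a b => // m IHm u w le_m a b uaw ubw.
have [aw|aw] := eqVneq a w; first by subst a; right; split=> //; apply: between_r.
have [bw|bw] := eqVneq b w; first by subst b; left; split=> //; apply: between_r.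
have [z zI azw] := indsys_factor HI aw.
have [z' z'I bz'w] := indsys_factor HI bw.
have [uzw uaz] := between_right Hf uaw azw.
have [_ ubz'] := between_right Hf ubw bz'w.
have [x nz] := redsys_neq0_apply Hf u w.
have im c d : between u c w -> between c d w -> f u w x \in limg (f d w).
  move=> ucw cdw; rewrite (betweenE _ ucw) (betweenE _ cdw).
  by rewrite memv_img ?memvf.
have ezz' := indep_eq z'I zI nz (im _ _ ubw bz'w) (im _ _ uaw azw).
subst z'; have zw := indsys_neq zI.
have lt_m : (#|factor_set u z| < m)%N.
  exact: leq_trans (factor_set_ltl Hf uzw zw) le_m.
case: (IHm u z lt_m a b uaz ubz') => -[h1 h2]; [left|right]; split=> //.
  by have [] := between_left Hf azw h2.
by have [] := between_left Hf bz'w h2.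
Qed.

Lemma ker_sub_limg u v : u != v ->
  exists2 z, z \in I v & (lker (f v u) <= limg (f z v))%VS.
Proof.
move=> uv; have [w [wv -> _]] := redsys_ker Hf uv.
by have [z zI wzv] := indsys_factor HI wv; exists z => //; apply: between_limg.
Qed.

(** Both kernels are images from neighbours [w], [w'] of [v] whose maps to [v] pass through [z].
    Adjacency puts [w] and [w'] between [v] and [z], where [between_chain] orders them, and this
    order carries over to the images. *)
Lemma ker_comparable z v u u' : z \in I v -> u != v -> u' != v ->
    (lker (f v u) <= limg (f z v))%VS -> (lker (f v u') <= limg (f z v))%VS ->
  (lker (f v u) <= lker (f v u'))%VS \/ (lker (f v u') <= lker (f v u))%VS.
Proof.
move=> zI uv u'v.
have [w [wv -> w_adj]] := redsys_ker Hf uv.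
have [w' [w'v -> w'_adj]] := redsys_ker Hf u'v.
have fac c : c != v -> (limg (f c v) <= limg (f z v))%VS -> between c z v.
  move=> cv /subvP cz; have [z' z'I cz'v] := indsys_factor HI cv.
  have [x nz] := redsys_neq0_apply Hf c v.
  have xc : f c v x \in limg (f c v) by rewrite memv_img ?memvf.
  by rewrite (indep_eq zI z'I nz (cz _ xc)) // (subvP (between_limg cz'v)).
have zv := indsys_neq zI.
move=> /(fac _ wv) wzv /(fac _ w'v) w'zv.
have vwz := w_adj z zv wzv; have vw'z := w'_adj z zv w'zv.
case: (between_chain vwz vw'z) => -[_ h]; [left|right]; apply: between_limg.
  by have [] := between_left Hf wzv h.
by have [] := between_left Hf w'zv h.
Qed.

(** The kernel lies in a single independent summand, so all other components of a sum in it
    vanish. *)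
Lemma ker_homogeneous v u kk : (forall w, w \in I v -> kk w \in limg (f w v)) ->
    \sum_(w in I v) kk w \in lker (f v u) ->
  forall w, w \in I v -> kk w \in lker (f v u).
Proof.
move=> kkI sK w wI; have [uv|uv] := eqVneq u v.
  subst u; have /directv_sum_independent dx := indsys_direct HI v.
  rewrite (dx kk) ?mem0v //; move: sK.
  by rewrite memv_ker redsys_id_apply // => /eqP.
have [z zI kz] := ker_sub_limg uv.
have [kkz kk0] := direct_sum_mem zI kkI kz sK.
by have [->//|wz] := eqVneq w z; rewrite kk0 ?mem0v.
Qed.

(** * The radical of a sub-representation and its generators *)

Section Subrepresentation.

Variable N : forall v, {vspace V v}.
Hypothesis N_sub : forall u v, (f u v @: N u <= N v)%VS.

Definition radical v := (\sum_(z in I v) f z v @: N z)%VS.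

Lemma radical_sub v : (radical v <= N v)%VS.
Proof. by apply/subv_sumP. Qed.

Lemma mem_radical u v x : u != v -> x \in N u -> f u v x \in radical v.
Proof.
move=> uv xN; have [z zI uzv] := indsys_factor HI uv.
rewrite (betweenE _ uzv); apply: (subvP (sumv_sup z zI (subvv _))).
by apply/memv_img/(subvP (N_sub u z))/memv_img.
Qed.

Lemma radicalP v x : x \in radical v -> exists2 y : forall z, V z,
  forall z, y z \in N z & x = \sum_(z in I v) f z v (y z).
Proof.
case/memv_sumP=> vs vsP ->.
have ex z : exists y, y \in N z /\ (z \in I v -> vs z = f z v y).
  have [zI|] := boolP (z \in I v); last by exists 0; rewrite mem0v.
  by have /memv_imgP[y yN e] := vsP z zI; exists y.
exists (fun z => sval (cid (ex z))) => [z|]; first by case: (cid (ex z)) => ? [].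
by apply: eq_bigr => z zI; case: (cid (ex z)) => /= y [_ ->].
Qed.

Lemma radical_graded v :
  graded (mem (I v)) (fun z => limg (f z v)) (radical v).
Proof.
move=> kk kkI /radicalP[y yN e] z zI.
have /directv_sum_unique dx := indsys_direct HI v.
have im w : w \in I v -> f w v (y w) \in limg (f w v) by rewrite memv_img ?memvf.
have := dx _ _ kkI im; rewrite e eqxx => /esym/forall_inP/(_ z zI)/eqP ->.
by apply: mem_radical => //; apply: indsys_neq.
Qed.

Definition split_generators v (X : seq (V v)) :=
  [/\ {subset X <= N v}, (N v <= radical v + <<X>>)%VS,
      forall x, x \in X -> x \notin radical v
    & forall u, splits (lker (f v u)) (radical v) X].

Lemma split_generators_ex v : exists X : seq (V v), split_generators X.
Proof.
have F_sub j : j != v -> exists2 i, i \in I v & (lker (f v j) <= limg (f i v))%VS.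
  exact: ker_sub_limg.
have F_chain i j j' : i \in I v -> j != v -> j' != v ->
    (lker (f v j) <= limg (f i v))%VS -> (lker (f v j') <= limg (f i v))%VS ->
    (lker (f v j) <= lker (f v j'))%VS \/ (lker (f v j') <= lker (f v j))%VS.
  exact: ker_comparable.
have [X [XN NX Xr X0 XF]] :=
  adapted_generators F_sub F_chain (radical_sub v) (@radical_graded v).
exists X; split=> // u; have [->|uv] := eqVneq u v; last exact: XF.
suff -> : lker (f v v) = 0%VS by [].
by apply/eqP/lker0P=> x y; rewrite !redsys_id_apply.
Qed.

Section Generators.

Variable X : forall v, seq (V v).
Hypothesis XP : forall v, split_generators (X v).

Lemma span_generators_sub v : (<<X v>> <= N v)%VS.
Proof. by have [XN _ _ _] := XP v; apply/span_subvP. Qed.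

Lemma generators_split v (c n : V v) u : c \in <<X v>>%VS -> n \in radical v ->
  n + c \in lker (f v u) -> c \in lker (f v u).
Proof.
move=> cX nr; have [_ _ _ sp] := XP v.
pose a j := if insub j is Some i then coord (in_tuple (X v)) i c else 0.
have -> : c = \sum_(i < size (X v)) a i *: (X v)`_i.
  rewrite {1}(coord_span (X := in_tuple (X v)) cX); apply: eq_bigr => i _; congr (_ *: _).
  by rewrite /a valK.
by move=> /(sp u a n nr) aK; apply: rpred_sum => i _; apply: aK.
Qed.

(* The summands with source [v != w] are grouped by the element of [I w] that    *)
(* [f v w] factors through; the bound [m] decreases from [w] to these elements. *)
Lemma generators_independent_rec m w u (c : forall v, V v) :
    (forall v, c v \in <<X v>>%VS) ->
    (forall v, c v != 0 -> (#|factor_set v w| <= m)%N) ->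
    \sum_v f v w (c v) \in lker (f w u) ->
  forall v, f v w (c v) \in lker (f w u).
Proof.
elim: m => [|m IHm] in w u c * => cT cm sK v.
  have [->|/cm] := eqVneq (c v) 0; first by rewrite linear0 mem0v.
  by rewrite leqNgt factor_set_gt0.
(* The choice at [a = w] is a placeholder, which [c'] discards. *)
have ex a : exists z, a != w -> z \in I w /\ between a z w.
  have [->|aw] := eqVneq a w; first by exists w.
  by have [z zI azw] := indsys_factor HI aw; exists z.
have [sel selP] := choice ex.
pose c' z a : V a := if (a != w) && (sel a == z) then c a else 0.
have c'T z a : c' z a \in <<X a>>%VS.
  by rewrite /c'; case: ifP => _; rewrite ?mem0v.
pose y z := \sum_a f a z (c' z a).
have e : \sum_(a | a != w) f a w (c a) = \sum_(z in I w) f z w (y z).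
  under [RHS]eq_bigr do rewrite linear_sum.
  rewrite exchange_big big_mkcond /=; apply: eq_bigr => a _.
  case: ifPn => [aw|aw]; last first.
    by rewrite big1 // => z _; rewrite /c' (negPf aw) !linear0.
  have [sI sB] := selP a aw; rewrite (bigD1 (sel a)) //= big1 ?addr0.
    by rewrite /c' aw eqxx -betweenE.
  by move=> z /andP[_ zs]; rewrite /c' aw eq_sym (negPf zs) !linear0.
have yN z : y z \in N z.
  apply: rpred_sum => a _; apply: (subvP (N_sub a z)); apply: memv_img.
  exact: (subvP (span_generators_sub a)).
have yr : \sum_(z in I w) f z w (y z) \in radical w.
  by apply: rpred_sum => z zI; apply: mem_radical (indsys_neq zI) (yN z).
(* All terms with source other than [w] lie in the radical, so splitting isolates [c w]. *)
have cwK : c w \in lker (f w u).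
  apply: (generators_split (u := u) (cT w) yr); rewrite -e addrC.
  by rewrite (bigD1 w) //= redsys_id_apply in sK.
have [->|vw] := eqVneq v w; first by rewrite redsys_id_apply.
have yK : \sum_(z in I w) f z w (y z) \in lker (f w u).
  by rewrite (bigD1 w) //= redsys_id_apply // rpredDl // e in sK.
have [sI sB] := selP v vw; set z := sel v in sI sB.
have fyK : f z w (y z) \in lker (f w u).
  by apply: (ker_homogeneous _ yK sI) => z' _; rewrite memv_img ?memvf.
have zw := indsys_neq sI.
have vz : c v = c' z v by rewrite /c' vw eqxx.
(* If [f z u] factors through [w], then [y z] lies in the kernel of [f z u]: this is the claim at
   [z] with the same [u], which is why [u] is arbitrary. *)
rewrite (betweenE _ sB) vz; case: (redsys_comp_apply Hf z w u) => zwu; last first.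
  by rewrite memv_ker zwu.
rewrite memv_ker -betweenE // -memv_ker; apply: IHm => [a|a|].
- exact: c'T.
- rewrite /c'; case: ifP => [/andP[aw /eqP az] ca|]; last by rewrite eqxx.
  have [_ azw] := selP a aw; rewrite az in azw.
  by rewrite -ltnS; apply: leq_trans (factor_set_ltl Hf azw zw) (cm a ca).
by rewrite memv_ker (betweenE _ zwu) -memv_ker.
Qed.

Lemma generators_independent w (c : forall v, V v) :
    (forall v, c v \in <<X v>>%VS) -> \sum_v f v w (c v) = 0 ->
  forall v, f v w (c v) = 0.
Proof.
move=> cX s0 v; have sK : \sum_v f v w (c v) \in lker (f w w) by rewrite s0 mem0v.
have := generators_independent_rec cX (fun v _ => max_card _) sK v.
by rewrite memv_ker redsys_id_apply // => /eqP.
Qed.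

(** Replace [N z] by its generators and its radical. The radical contributes images of [N t], which
    either die in [w] or have a strictly larger [factor_set t w]; since [Gamma] is finite this
    stops. *)
Lemma generators_span w : N w = (\sum_v f v w @: <<X v>>)%VS.
Proof.
apply/subv_anti/andP; split; last first.
  apply/subv_sumP => v _; apply: subv_trans (N_sub v w).
  exact/limgS/span_generators_sub.
suff H m z : (#|Gamma| - #|factor_set z w| < m)%N ->
    (f z w @: N z <= \sum_v f v w @: <<X v>>)%VS.
  have := H _ w (ltnSn _); rewrite (redsys_id Hf) /=.
  by apply: subv_trans; rewrite lim1g.
elim: m => // m IHm in z * => zm.
have [_ /(limgS (f z w)) NX _ _] := XP z; apply: subv_trans NX _.
rewrite limgD subv_add; apply/andP; split; last exact: (sumv_sup z).
rewrite limg_sum; apply/subv_sumP => t tI.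
have tz := indsys_neq tI.
rewrite -limg_comp; case: (redsys_comp Hf t z w) => [tzw|->]; last first.
  by apply/subvP=> _ /memv_imgP[y _ ->]; rewrite lfunE mem0v.
rewrite -(eqP tzw); apply: IHm; rewrite ltnS in zm; apply: leq_trans zm.
have lt := factor_set_ltr Hf tzw tz.
exact: ltn_sub2l (leq_trans lt (max_card _)) lt.
Qed.

End Generators.

(** Independence is stated term by term because a generator of [N] may be killed by some of the
    maps. *)
Theorem subrep_decomposition : exists n (src : 'I_n -> Gamma) (x : forall i, V (src i)),
  [/\ forall i, x i \in N (src i),
      forall i, x i \notin radical (src i),
      forall w, N w = (\sum_i <[f (src i) w (x i)]>)%VS
    & forall w (a : 'I_n -> k), \sum_i a i *: f (src i) w (x i) = 0 ->
        forall i, a i *: f (src i) w (x i) = 0].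
Proof.
pose X v := sval (cid (split_generators_ex v)).
have XP v : split_generators (X v) := svalP (cid (split_generators_ex v)).
pose T : finType := {v : Gamma & 'I_(size (X v))}.
pose ind (t : T) : 'I_(size (X (tag t))) := tagged t.
pose gen (t : T) : V (tag t) := (X (tag t))`_(ind t).
exists #|T|, (fun i => tag (enum_val i : T)), (fun i => gen (enum_val i)).
have genX (t : T) : gen t \in X (tag t) by rewrite mem_nth.
split=> [i|i|w|w a s0 i].
- by have [XN _ _ _] := XP (tag (enum_val i : T)); apply/XN/genX.
- by have [_ _ Xr _] := XP (tag (enum_val i : T)); apply/Xr/genX.
- rewrite (generators_span XP w).
  rewrite -(big_enum_val (A := T) (fun t => <[f (tag t) w (gen t)]>%VS)).
  rewrite -(sig_big_dep xpredT (fun _ => xpredT)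
    (fun v (i : 'I_(size (X v))) => <[f v w (X v)`_i]>%VS)) /=.
  apply: eq_bigr => v _; rewrite limg_span span_def big_map (big_nth 0) big_mkord.
  by [].
have TK (t : T) : Tagged (fun v => 'I_(size (X v))) (ind t) = t by case: t.
pose b v j := if (insub j : option 'I_(size (X v))) is Some i
  then a (enum_rank (Tagged (fun v => 'I_(size (X v))) i)) else 0.
pose c v := \sum_(i < size (X v)) b v i *: (X v)`_i.
have cX v : c v \in <<X v>>%VS.
  by apply: rpred_sum => j _; rewrite memvZ // memv_span // mem_nth.
have cs : \sum_v f v w (c v) = 0.
  pose F v (i : 'I_(size (X v))) := f v w (b v i *: (X v)`_i).
  rewrite -[RHS]s0; transitivity (\sum_v \sum_i F v i).
    by apply: eq_bigr => v _; rewrite linear_sum.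
  rewrite (sig_big_dep xpredT (fun _ => xpredT) F) /=.
  rewrite (big_enum_val (A := T) (fun t : T => f (tag t) w (b (tag t) (ind t) *: gen t))).
  apply: eq_bigr => j _; rewrite linearZ /=; congr (_ *: _).
  by rewrite /b valK TK enum_valK.
have [_ _ _ sp] := XP (tag (enum_val i)).
have /eqP := generators_independent XP cX cs (tag (enum_val i)).
rewrite -memv_ker -[c _]add0r => /(sp w _ _ (mem0v _))/(_ _ (ltn_ord (ind (enum_val i)))).
rewrite memv_ker linearZ /= => /eqP; rewrite /b valK.
by rewrite TK enum_valK.
Qed.

End Subrepresentation.
End IndependentSystem.
End IndependentSystems.

(** * Reduction maps between lattices *)

Section LatticeIndices.

Variables (R : dvr) (d : nat).
Hypothesis d_gt0 : (0 < d)%N.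

Local Notation K := {fraction R}.
Local Notation piK := (piK R).
Implicit Types (L : lattice R d) (x : 'rV[K]_d).

Lemma piK_scale m n x : piK ^ m *: (piK ^ n *: x) = piK ^ (m + n) *: x.
Proof. by rewrite scalerA -expfzDr ?piK_neq0. Qed.

Lemma lat_index_min L1 L2 (m : int) :
  (forall x, lat_set L1 x -> lat_set L2 (piK ^ m *: x)) -> lat_index L1 L2 <= m.
Proof. exact: (lat_indexP L1 L2 d_gt0).2. Qed.

Lemma lat_pi_closed L (m : int) x : 0 <= m -> lat_set L x -> lat_set L (piK ^ m *: x).
Proof.
case: m => // m _ /(lat_scale_closed (uniformizer R ^+ m)).
by rewrite rmorphXn.
Qed.

Lemma lat_index_mem L1 L2 (m : int) x :
  lat_index L1 L2 <= m -> lat_set L1 x -> lat_set L2 (piK ^ m *: x).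
Proof.
move=> le_m L1x; rewrite -(subrK (lat_index L1 L2) m) -piK_scale.
by apply: lat_pi_closed; [rewrite subr_ge0 | apply: lat_index_sub].
Qed.

Lemma lat_index_self L : lat_index L L = 0.
Proof.
apply/eqP; rewrite eq_le lat_index_min; last by move=> x; rewrite expr0z scale1r.
by apply: (lat_index_ge0 (L := L)) => // x; apply: lat_index_sub.
Qed.

Lemma lat_index_triangle L1 L2 L3 :
  lat_index L1 L3 <= lat_index L1 L2 + lat_index L2 L3.
Proof.
apply: lat_index_min => x L1x; rewrite addrC -piK_scale.
by apply/lat_index_sub/lat_index_sub.
Qed.

Lemma homothetic_index L1 L2 :
  lat_index L1 L2 + lat_index L2 L1 = 0 -> homothetic L1 L2.
Proof.
move=> e; exists (piK ^ lat_index L1 L2); first by rewrite expfz_neq0 ?piK_neq0.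
apply/seteqP; split=> x /=; last by case=> y L1y <-; apply: lat_index_sub.
move=> L2x; exists (piK ^ lat_index L2 L1 *: x); first exact: lat_index_sub.
by rewrite piK_scale e expr0z scale1r.
Qed.

Lemma frac_unit_pi (a : K) : a != 0 ->
  exists u : R, u \is a GRing.unit /\ exists n : int, a = tofracR u * piK ^ n.
Proof.
move=> a0; have [r [s [s0 ea]]] := fracE_ex a.
have r0 : r != 0.
  by apply: contraNneq a0 => r0; rewrite ea r0 rmorph0 mul0r.
have [u uU [m er]] := dvr_factor r0; have [v vU [n es]] := dvr_factor s0.
exists (u * v^-1); split; first by rewrite unitrMr ?unitrV.
exists (m%:Z - n%:Z); rewrite ea er es !rmorphM !rmorphXn /=.
have v0 : tofracR v != 0.
  by rewrite tofrac_eq0; apply: contraTneq vU => ->; rewrite unitr0.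
have -> : tofracR v^-1 = (tofracR v)^-1.
  by apply: (mulfI v0); rewrite mulfV // -rmorphM divrr // rmorph1.
rewrite expfzDr ?piK_neq0 // invfM -!mulrA; congr (_ * _).
by rewrite mulrCA -exprnN.
Qed.

Lemma homotheticP L (S : set 'rV[K]_d) : homothetic L S ->
  exists k : int, forall x, S x <-> lat_set L (piK ^ (- k) *: x).
Proof.
case=> a a0 ->; have [u [uU [k ea]]] := frac_unit_pi a0; exists k => x.
split=> [[y Ly <-]|Lx].
  rewrite ea scalerA mulrCA -expfzDr ?piK_neq0 // addNr expr0z mulr1.
  exact: lat_scale_closed.
exists (tofracR u^-1 *: (piK ^ (- k) *: x)); first exact: lat_scale_closed.
rewrite !scalerA ea (mulrAC (tofracR u)) -rmorphM mulrV // rmorph1 mul1r.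
by rewrite -expfzDr ?piK_neq0 // subrr expr0z scale1r.
Qed.

Lemma red_map_comp L1 L2 L3 q :
  red_map L2 L3 (red_map L1 L2 q) =
    if lat_index L1 L2 + lat_index L2 L3 == lat_index L1 L3 then red_map L1 L3 q else 0.
Proof.
have [x ->] := to_red_surj q; rewrite !red_mapE.
case: eqP => [e|ne].
  by congr to_red; apply: val_inj; rewrite /= piK_scale addrC e.
rewrite -to_red0; apply/to_red_eq.
have le1 : lat_index L1 L3 <= lat_index L1 L2 + lat_index L2 L3 - 1.
  by have := lat_index_triangle L1 L2 L3; lia.
have /lat_index_mem/(_ (lat_predP L1 (val x) (valP x)))/lat_predP mem := le1.
exists (LatElt mem); apply: val_inj; rewrite subr0 /=.
rewrite -[tofracR _]expr1z -/(Defs.piK R) !piK_scale; congr (_ ^ _ *: _); lia.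
Qed.

(** If the map vanished, one power of the uniformizer could be divided out, against the minimality
    of [lat_index]. *)
Lemma red_map_neq0 L1 L2 : red_map L1 L2 != 0.
Proof.
apply/eqP=> e; suff : lat_index L1 L2 <= lat_index L1 L2 - 1 by lia.
apply: lat_index_min => x /lat_predP L1x.
have : red_map L1 L2 (to_red (LatElt L1x)) = to_red 0 by rewrite e lfunE to_red0.
rewrite red_mapE => /to_red_eq[z /(congr1 val)]; rewrite subr0 /=.
rewrite -[tofracR _]expr1z -/(Defs.piK R) => /(congr1 ( *:%R (piK ^ (-1)))).
rewrite !piK_scale addNr expr0z scale1r [_ - 1]addrC => ->.
exact/lat_predP/(valP z).
Qed.

Lemma red_map_self L : red_map L L = \1%VF.
Proof.
apply/lfunP=> q; have [x ->] := to_red_surj q; rewrite red_mapE id_lfunE.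
by congr to_red; apply: val_inj; rewrite /= lat_index_self expr0z scale1r.
Qed.

Lemma to_red_eq0 L (x : lat_elt L) :
  to_red x = 0 <-> lat_set L (piK ^ (-1) *: val x).
Proof.
rewrite -to_red0; split=> [/to_red_eq[z]|/lat_predP mem].
  rewrite subr0 => -> /=; rewrite -[tofracR _]expr1z -/(Defs.piK R) piK_scale addNr.
  by rewrite expr0z scale1r; apply/lat_predP/(valP z).
apply/to_red_eq; exists (LatElt mem); apply: val_inj; rewrite subr0 /=.
by rewrite -[tofracR _]expr1z -/(Defs.piK R) piK_scale subrr expr0z scale1r.
Qed.

Lemma red_map_between (Gamma : finType) (L : Gamma -> lattice R d) u w v :
  between (fun u v => red_map (L u) (L v)) u w v =
    (lat_index (L u) (L w) + lat_index (L w) (L v) == lat_index (L u) (L v)).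
Proof.
apply/eqP/idP => [e|e]; last first.
  by apply/lfunP=> q; rewrite comp_lfunE red_map_comp e.
apply: contraNT (red_map_neq0 (L u) (L v)) => /negPf ne; rewrite e.
by apply/eqP/lfunP=> q; rewrite comp_lfunE red_map_comp ne lfunE.
Qed.

End LatticeIndices.

(** * Convexity turns kernels into images *)

Section ConvexConfigurations.

Variables (R : dvr) (d : nat) (Gamma : finType) (L : Gamma -> lattice R d).
Hypothesis d_gt0 : (0 < d)%N.
Hypothesis L_convex : convex_config L.

Local Notation K := {fraction R}.
Local Notation piK := (piK R).
Local Notation n u v := (lat_index (L u) (L v)).
Local Notation f := (fun u v => red_map (L u) (L v)).

Lemma index_loop u v : u != v -> 1 <= n u v + n v u.
Proof.
move=> uv; have ge0 : 0 <= n u v + n v u.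
  by have := lat_index_triangle d_gt0 (L u) (L v) (L u); rewrite lat_index_self.
have [_ inj _] := L_convex; have ne0 : n u v + n v u != 0.
  by apply: contraNneq uv => /homothetic_index/inj ->.
lia.
Qed.

(* The class [w] is that of [pi^-1 L_v] intersected with [pi^-n L_u], where      *)
(* [n = n v u]: it is adjacent to [v] and contained in the former.              *)
Lemma convex_ker u v : u != v -> exists w,
  [/\ w != v, lker (f v u) = limg (f w v)
    & forall z, z != v -> between f w z v -> between f v w z].
Proof.
move=> uv; have [_ _ /(_ u v)] := L_convex.
have pi0 m : piK ^ m != 0 by rewrite expfz_neq0 ?piK_neq0.
move=> /(_ _ _ (pi0 (- n v u)) (pi0 (-1)))[w /homotheticP[k]].
set X := (_ `&` _)%classic => Xw; exists w.
have XE y : X y <-> lat_set (L u) (piK ^ n v u *: y) /\ lat_set (L v) (piK ^ 1 *: y).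
  have im (c : int) v' : [set piK ^ (- c) *: x | x in lat_set (L v')]%classic y <->
      lat_set (L v') (piK ^ c *: y).
    split=> [[x Lx <-]|Lx]; first by rewrite piK_scale subrr expr0z scale1r.
    by exists (piK ^ c *: y) => //; rewrite piK_scale addNr expr0z scale1r.
  by rewrite -!im.
have n_wv : n w v <= k + 1.
  apply: lat_index_min => // y Ly; rewrite addrC -piK_scale.
  by apply: (proj2 ((XE _).1 _)); apply/Xw; rewrite piK_scale addNr expr0z scale1r.
have n_vw : n v w <= - k.
  apply: lat_index_min => // x Lx; apply/Xw/XE; split; first exact: lat_index_sub.
  exact: lat_pi_closed.
have uv1 := index_loop uv.
(* Here [X] is [pi^k L_w] and contains [L_v]. If [w = v], then [X] is [L_v] or [pi^-1 L_v],
   contradicting the minimality of [n u v] or of [n v u] respectively. *)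
have wv : w != v.
  apply/eqP=> ewv; subst w; rewrite lat_index_self // in n_wv n_vw.
  have [k0|k1] : k = 0 \/ k = -1 by lia.
    suff : n u v <= n u v - 1 by lia.
    apply: lat_index_min => // x Lx; have /Xw : X (piK ^ (n u v - 1) *: x).
      apply/XE; rewrite !piK_scale; split; first by apply: lat_pi_closed => //; lia.
      by rewrite addrC subrK; apply: lat_index_sub.
    by rewrite k0 oppr0 expr0z scale1r.
  suff : n v u <= n v u - 1 by lia.
  apply: lat_index_min => // x Lx; rewrite -piK_scale.
  by apply: (proj1 ((XE _).1 _)); apply/Xw; rewrite k1 piK_scale subrr expr0z scale1r.
have wv1 := index_loop wv; split=> // [|z zv].
  apply/vspaceP=> q; apply/idP/idP.
    have [x ->] := to_red_surj q; rewrite memv_ker red_mapE => /eqP/to_red_eq0 /=.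
    rewrite piK_scale => xu.
    have /Xw Lw : X (piK ^ (-1) *: val x).
      apply/XE; rewrite !piK_scale subrr expr0z scale1r addrC; split=> //.
      exact/lat_predP/valP.
    have /lat_predP mem := Lw.
    have -> : to_red x = f w v (to_red (LatElt mem)).
      rewrite red_mapE; congr to_red; apply: val_inj => /=.
      rewrite !piK_scale -[LHS]scale1r -(expr0z piK); congr (_ ^ _ *: _); lia.
    by rewrite memv_img ?memvf.
  case/memv_imgP=> r _ ->; have [y ->] := to_red_surj r.
  rewrite memv_ker !red_mapE; apply/eqP/to_red_eq0 => /=; rewrite !piK_scale.
  have -> : -1 + n v u + n w v = n v u + k by lia.
  rewrite -piK_scale; apply: (proj1 ((XE _).1 _)); apply/Xw.
  by rewrite piK_scale addNr expr0z scale1r; apply/lat_predP/valP.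
(* The bounds give [n v w + n w v = 1], so [n v w + n w z = 1 - n z v], which is at most [n v z] by
   [index_loop]; the triangle inequality gives the converse. *)
rewrite !red_map_between // => /eqP wzv; apply/eqP.
have := lat_index_triangle d_gt0 (L v) (L w) (L z); have := index_loop zv; lia.
Qed.

Lemma convex_reduction_system : reduction_system f.
Proof.
split=> [u|u v|u w v|u v uv|u v]; last exact: convex_ker.
- exact: red_map_self.
- exact: red_map_neq0.
- rewrite red_map_between //; case: eqP => [|ne]; [by left | right].
  apply/lfunP=> q; rewrite comp_lfunE red_map_comp // zero_lfunE.
  by case: eqP.
apply/lfunP=> q; rewrite comp_lfunE red_map_comp // zero_lfunE lat_index_self //.
by have := index_loop uv; case: eqP => // ->.
Qed.

Lemma lwi_independent_system : locally_weakly_independent L ->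
  exists I, independent_system f I.
Proof.
move=> lwi; pose I v := sval (cid (lwi v)); exists I.
split=> [|v|u v|v]; first exact: convex_reduction_system.
all: rewrite /I; case: (cid _) => /= J [vJ fJ dJ] //.
by move=> /fJ[w wJ e]; exists w => //; apply/eqP.
Qed.

End ConvexConfigurations.

(** * The quiver of a convex configuration *)

Fixpoint qcat (T : Type) (Q : rel T) u w v (p : qpath Q u w) : qpath Q w v -> qpath Q u v :=
  match p in qpath _ u w return qpath Q w v -> qpath Q u v with
  | QNil _ => id
  | QCons _ _ _ a p' => fun q => QCons a (qcat p' q)
  end.

Lemma qcomp_cat (k : fieldType) (T : Type) (Q : rel T) (M : qrep k Q) u w v
    (p : qpath Q u w) (q : qpath Q w v) (x : M u) :
  qcomp (M := M) (qcat p q) x = qcomp (M := M) q (qcomp (M := M) p x).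
Proof. by elim: p q x => //= *. Qed.

Lemma qhom_comp (k : fieldType) (T : Type) (Q : rel T) (M N : qrep k Q) (h : qhom M N)
    u v (p : qpath Q u v) (x : M u) :
  qhom_map h v (qcomp (M := M) p x) = qcomp (M := N) p (qhom_map h u x).
Proof. by elim: p x => //= {}u w {}v a p IHp x; rewrite IHp qhom_comm. Qed.

Section ConfigurationQuiver.

Variables (R : dvr) (d : nat) (Gamma : finType) (L : Gamma -> lattice R d).
Hypothesis d_gt0 : (0 < d)%N.
Hypothesis L_convex : convex_config L.

Local Notation Lbar v := (lat_red (L v)).
Local Notation f := (fun u v => red_map (L u) (L v)).
Local Notation Q := (config_quiver L).
Local Notation M := (config_rep L).

Let Hf : reduction_system f := convex_reduction_system d_gt0 L_convex.

Lemma qcomp_reduction (Q' : rel Gamma) u v (p : qpath Q' u v) :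
  (forall x, qcomp (M := reduction_rep L Q') p x = f u v x) \/
  (forall x, qcomp (M := reduction_rep L Q') p x = 0).
Proof.
elim: p => [{}u|{}u w {}v a p [IHp|IHp]] /=.
- by left=> x; rewrite (redsys_id_apply Hf).
- case: (redsys_comp_apply Hf u w v) => [uwv|uwv0]; [left|right] => x.
    by rewrite IHp (betweenE (f := f) x uwv).
  by rewrite IHp uwv0.
by right=> x; rewrite IHp.
Qed.

Lemma qcomp_loop u v (p : qpath (@full_quiver Gamma) u v) :
  (0 < qlength p)%N -> u = v ->
  forall x, qcomp (M := reduction_rep L (@full_quiver Gamma)) p x = 0.
Proof.
case: p => // {}u w {}v a p _ e x; subst v => /=.
by case: (qcomp_reduction p) => -> //; apply: (redsys_cycle_apply Hf).
Qed.

Lemma removed_arrow u v : u != v -> ~~ Q u v ->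
  exists w, [/\ u != w, w != v & between f u w v].
Proof.
move=> uv; rewrite /config_quiver uv => /asboolPn/contrapT[p].
have [x nz] := redsys_neq0_apply Hf u v.
case: p x nz => // {uv}{}u w {}v a p x nz p1 e; exists w.
have {e}e y : f u v y = qcomp (M := reduction_rep L (@full_quiver Gamma)) p (f u w y).
  by rewrite -e.
(* Otherwise the rest of the path is a loop of positive length, whose composite is zero. *)
have wv : w != v.
  by apply: contraNneq nz => wv; rewrite e qcomp_loop.
split=> //; apply/eqP/lfunP => y; rewrite comp_lfunE e.
by case: (qcomp_reduction p) => [->//|p0]; rewrite e p0 eqxx in nz.
Qed.

(** Removing arrows loses no map: a removed arrow factors through a proper intermediate vertex, and
    both halves are shorter as measured by [factor_set]. *)
Lemma config_path u v : exists p : qpath Q u v, forall x, qcomp (M := M) p x = f u v x.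
Proof.
elim: {u v}_.+1 {-2}u {-2}v (ltnSn #|factor_set f u v|) => // m IHm u v uvm.
have [<-|uv] := eqVneq u v.
  by exists (QNil _ _) => x /=; rewrite (redsys_id_apply Hf).
have [a|Quv] := boolP (Q u v); first by exists (QCons a (QNil _ _)).
have [w [uw wv uwv]] := removed_arrow uv Quv.
have [p pE] := IHm u w (leq_trans (factor_set_ltl Hf uwv wv) uvm).
have [q qE] := IHm w v (leq_trans (factor_set_ltr Hf uwv uw) uvm).
by exists (qcat p q) => x; rewrite qcomp_cat pE qE (betweenE (f := f) x uwv).
Qed.

Lemma is_subrepP (N : forall v, {vspace Lbar v}) :
  is_subrep N <-> forall u v, (f u v @: N u <= N v)%VS.
Proof.
split=> [sN u v|sN u v _]; last exact: sN.
have [p pE] := config_path u v.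
apply/subvP=> _ /memv_imgP[x xN ->]; rewrite -pE => {pE}.
elim: p x xN => //= {}u w {}v a p IHp x xN; apply: IHp.
by apply: (subvP (sN u w a)); apply: memv_img.
Qed.

Lemma line_subrep u (x : Lbar u) : is_subrep (fun v => <[f u v x]>%VS).
Proof.
apply/is_subrepP => v w; rewrite limg_line -memvE.
case: (redsys_comp_apply Hf u v w) => [uvw|->]; last exact: mem0v.
by rewrite -(betweenE (f := f) x uvw) memv_line.
Qed.

Lemma line_generated u (x : Lbar u) : generated_by (fun v => <[f u v x]>%VS) x.
Proof.
split=> [||N /is_subrepP sN xN w]; first exact: line_subrep.
  by rewrite (redsys_id_apply Hf) memv_line.
by rewrite -memvE; apply: (subvP (sN u w)); apply: memv_img.
Qed.

Variable I : Gamma -> {set Gamma}.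
Hypothesis HI : independent_system f I.

Lemma subrep_sum_of_lines (N : forall v, {vspace Lbar v}) : is_subrep N ->
  exists (n : nat) (S : 'I_n -> forall v, {vspace Lbar v}),
    [/\ forall i, is_subrep (S i), is_direct_sum N S,
        forall i, exists v (x : Lbar v), generated_by (S i) x
      & forall i v, (\dim (S i v) <= 1)%N].
Proof.
move=> /is_subrepP sN; have [n [src [x [_ _ spanN indep]]]] := subrep_decomposition HI sN.
exists n, (fun i v => <[f (src i) v (x i)]>%VS); split.
- by move=> i; apply: line_subrep.
- move=> v; split; last exact: spanN.
  suff: directv (\sum_i <[f (src i) v (x i)]>) by [].
  apply/directv_sum_independent => us usP s0 i _.
  have ex j : exists a, us j = a *: f (src j) v (x j).
    by apply/vlineP; apply: usP.
  have [a aE] := choice ex; rewrite aE; apply: (indep v a).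
  by rewrite -[RHS]s0; apply: eq_bigr => j _; rewrite aE.
- by move=> i; exists (src i), (x i); apply: line_generated.
by move=> i v; rewrite dim_vline leq_b1.
Qed.

(** For the whole representation, each kernel at a vertex lies in the radical there, so a generator
    outside the radical has nonzero image everywhere. *)
Lemma projective_basis : exists n (src : 'I_n -> Gamma) (x : forall i, Lbar (src i)),
  forall w, basis_of fullv [tuple f (src i) w (x i) | i < n].
Proof.
have sN u v : (f u v @: fullv <= fullv)%VS by apply: subvf.
have [n [src [x [_ xrad spanN indep]]]] := subrep_decomposition HI sN.
exists n, src, x => w; apply/andP; split.
  rewrite spanN span_def big_tuple; apply/eqP/eq_bigr => i _.
  by rewrite tnth_mktuple.
apply/freeP => a s0 i; apply/eqP.
have nz : f (src i) w (x i) != 0.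
  apply: contraNneq (xrad i) => fx0; have [e|ne] := eqVneq w (src i).
    subst w; rewrite (redsys_id_apply Hf) in fx0; by rewrite fx0 mem0v.
  have [z zI /subvP kz] := ker_sub_limg HI ne.
  have xz : x i \in limg (f z (src i)) by apply: kz; rewrite memv_ker fx0.
  by apply: (subvP (sumv_sup z zI (subvv _))).
have s1 : \sum_j a j *: f (src j) w (x j) = 0.
  by rewrite -[RHS]s0; apply: eq_bigr => j _; rewrite -tnth_nth tnth_mktuple.
by have /eqP := indep w a s1 i; rewrite scaler_eq0 (negPf nz) orbF.
Qed.

Lemma config_rep_projective : qprojective M.
Proof.
have [n [src [x bP]]] := projective_basis.
move=> N N' [zN eN] _ g gsurj h.
pose b w := [tuple f (src i) w (x i) | i < n].
have bE (i : 'I_n) w : (b w)`_i = f (src i) w (x i) by rewrite -tnth_nth tnth_mktuple.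
pose p i w : qpath Q (src i) w := sval (cid (config_path (src i) w)).
have pE i w (z : M (src i)) : qcomp (M := M) (p i w) z = f (src i) w z.
  exact: svalP (cid (config_path (src i) w)) z.
pose y i : N (src i) := sval (cid (gsurj (src i) (qhom_map h (src i) (x i)))).
have yE i : qhom_map g (src i) (y i) = qhom_map h (src i) (x i).
  exact: svalP (cid (gsurj (src i) (qhom_map h (src i) (x i)))).
pose e i w : N w := qcomp (M := N) (p i w) (y i).
have [h' h'E] : exists h' : forall w, {linear M w -> N w},
    forall w (z : Lbar w), h' w z = \sum_i coord (b w) i z *: e i w.
  pose hf w (z : M w) : N w := \sum_i coord (b w) i (z : Lbar w) *: e i w.
  have hlin w : linear (hf w).
    move=> c z z'; rewrite /hf scaler_sumr -big_split /=; apply: eq_bigr => i _.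
    by rewrite linearP scalerDl scalerA.
  pose hl w : {linear M w -> N w} :=
    HB.pack (hf w) (GRing.isLinear.Build _ _ _ _ (hf w) (hlin w)).
  by exists hl.
have h'b i w : h' w (f (src i) w (x i)) = e i w.
  rewrite -bE h'E (bigD1 i) //= coord_free ?(basis_free (bP w)) // eqxx scale1r.
  rewrite big1 ?addr0 // => j ji.
  by rewrite coord_free ?(basis_free (bP w)) // eq_sym (negPf ji) scale0r.
have decomp w (z : Lbar w) : z = \sum_i coord (b w) i z *: f (src i) w (x i).
  rewrite {1}(coord_basis (bP w) (memvf z)); apply: eq_bigr => i _.
  by rewrite bE.
have hcomm u v (a : Q u v) z : h' v (qmap M a z) = qmap N a (h' u z).
  rewrite [h' u z]h'E {1}(decomp u z) !linear_sum; apply: eq_bigr => i _; rewrite !linearZ.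
  congr (_ *: _) => /=; pose q := qcat (p i u) (QCons a (QNil _ _)).
  have qM z' : qcomp (M := M) q z' = f u v (f (src i) u z').
    by rewrite qcomp_cat pE.
  (* In [M] the path [q] either agrees with the chosen path [p i v] or is zero; [N] inherits either
     relation. *)
  have -> : qmap N a (e i u) = qcomp (M := N) q (y i) by rewrite qcomp_cat.
  case: (redsys_comp_apply Hf (src i) u v) => [iuv|iuv0].
    rewrite -(betweenE (f := f) _ iuv) h'b; apply: eN => z'.
    by rewrite qM pE (betweenE (f := f) _ iuv).
  by rewrite iuv0 linear0 zN // => z'; rewrite qM iuv0.
exists (QHom hcomm) => w z /=.
rewrite [h' w z]h'E [in RHS](decomp w z) !linear_sum.
apply: eq_bigr => i _; rewrite !linearZ; congr (_ *: _).
by rewrite /e qhom_comp yE -qhom_comp pE.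
Qed.

End ConfigurationQuiver.

(** * Lifting a basis to an apartment *)

Section Apartments.

Variables (R : dvr) (d : nat).

Local Notation K := {fraction R}.
Local Notation piK := (piK R).
Local Notation res := (residue_map R).

Lemma residue_unit (r : R) : res r != 0 -> r \is a GRing.unit.
Proof.
move=> r0; have rn : r != 0 by apply: contraNneq r0 => ->; rewrite rmorph0.
have [u uU [[|n] er]] := dvr_factor rn; first by rewrite er mulr1.
case/eqP: r0; apply/residue_map_ker; exists (u * uniformizer R ^+ n).
by rewrite er exprS mulrCA.
Qed.

(* Nakayama: a kernel vector of the matrix of coordinates modulo [pi] would be a *)
(* linear relation between the reductions.                                     *)
Lemma lat_coord_unit (L : lattice R d) (y : 'I_d -> lat_elt L) :
  free [tuple to_red (y i) | i < d] -> \matrix_i lat_coord (y i) \in unitmx.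
Proof.
move=> /freeP free_y; set C := \matrix_i _; rewrite unitmxE; apply: residue_unit.
rewrite -det_map_mx; apply/negP => /eqP/eqP/det0P[v /negP v0 vC]; apply: v0.
apply/eqP/rowP => i; rewrite mxE.
apply: (free_y (fun i => v 0 i)); clear i.
have ex j : exists t, \sum_i res_lift (v 0 i) * C i j = uniformizer R * t.
  apply/residue_map_ker; have /rowP/(_ j) := vC; rewrite !mxE => <-.
  by rewrite rmorph_sum; apply: eq_bigr => i _; rewrite rmorphM res_liftK !mxE.
have [t et] := choice ex.
have memt : map_mx (@tofracR R) (\row_j t j) *m lat_basis L \in lat_pred L.
  by apply/lat_predP/latP; exists (\row_j t j).
transitivity (to_red (\sum_i res_lift (v 0 i) *: y i)).
  rewrite (big_morph _ (@to_redD R d L) (@to_red0 R d L)); apply: eq_bigr => i _.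
  by rewrite -tnth_nth tnth_mktuple to_redZ res_liftK.
rewrite -to_red0; apply/to_red_eq; exists (LatElt memt); apply: val_inj.
rewrite subr0 [RHS]/= scalemxAl -map_mxZ raddf_sum /=.
under eq_bigr do rewrite lat_coordE scalemxAl -map_mxZ.
rewrite -mulmx_suml -map_mx_sum; congr (map_mx _ _ *m _).
by apply/rowP => j; rewrite summxE !mxE -et; apply: eq_bigr => i _; rewrite !mxE.
Qed.

Lemma row_lattice_unit (B : 'M[K]_d) (C : 'M[R]_d) : C \in unitmx ->
  row_lattice (map_mx (@tofracR R) C *m B) = row_lattice B.
Proof.
move=> CU; apply/seteqP; split=> _ [c _ <-].
  by exists (c *m C) => //; rewrite map_mxM mulmxA.
by exists (c *m invmx C) => //; rewrite mulmxA -map_mxM mulmxKV.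
Qed.

End Apartments.

(** Lifts [X i] of the generators, rescaled by powers of the uniformizer, reduce to a basis of each
    fibre; hence by Nakayama ([lat_coord_unit]) they form an [R]-basis of each [L w]. *)
Lemma projective_in_apartment (R : dvr) (d : nat) (Gamma : finType)
    (L : Gamma -> lattice R d) n (src : 'I_n -> Gamma)
    (x : forall i, lat_red (L (src i))) :
    (0 < #|Gamma|)%N ->
    (forall w, basis_of fullv [tuple red_map (L (src i)) (L w) (x i) | i < n]) ->
  in_apartment L.
Proof.
move=> /card_gt0P[w0 _] bP.
have nd : n = d.
  by rewrite -(size_basis (bP w0)) dimvf.
subst n.
pose X i := sval (cid (to_red_surj (x i))).
have XE i : x i = to_red (X i) := svalP (cid (to_red_surj (x i))).
pose E : 'M[{fraction R}]_d := \matrix_i lat_val (X i).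
pose c w i := lat_index (L (src i)) (L w).
pose C w := \matrix_i lat_coord (lat_mul (L w) (X i)).
have CU w : C w \in unitmx.
  apply: lat_coord_unit.
  have -> : [tuple to_red (lat_mul (L w) (X i)) | i < d]
      = [tuple red_map (L (src i)) (L w) (x i) | i < d].
    by apply: eq_from_tnth => i; rewrite !tnth_mktuple XE red_mapE.
  exact: basis_free (bP w).
have CE w : \matrix_i (piK R ^ c w i *: row i E) = map_mx (@tofracR R) (C w) *m lat_basis (L w).
  apply/row_matrixP => i; rewrite rowK row_mul -map_row !rowK -lat_coordE.
  by [].
exists E => [|w]; last first.
  exists (c w), 1; first exact: oner_neq0.
  rewrite CE row_lattice_unit // -lat_basisE.
  apply/seteqP; split=> y /=; first by move=> Ly; exists y; rewrite ?scale1r.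
  by case=> y' Ly' <-; rewrite scale1r.
(* Invertibility of [E] is read off at the single vertex [w0], where [E] differs from a lattice
   basis by a diagonal matrix and a unit matrix over [R]. *)
have : \matrix_i (piK R ^ c w0 i *: row i E) \in unitmx.
  by rewrite CE unitmx_mul lat_basis_unit andbT unitmxE det_map_mx rmorph_unit // -unitmxE.
have -> : \matrix_i (piK R ^ c w0 i *: row i E) = diag_mx (\row_i piK R ^ c w0 i) *m E.
  by rewrite mul_diag_mx; apply/matrixP => i j; rewrite !mxE.
by rewrite unitmx_mul => /andP[].
Qed.

Theorem theorem4p13 (R : dvr)
    (kappa_closed : GRing.closed_field_axiom (residue_field R))
    (d : nat) (d_gt0 : (0 < d)%N)
    (Gamma : finType) (L : Gamma -> lattice R d)
    (L_convex : convex_config L) (L_lwi : locally_weakly_independent L) :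
  [/\ forall N : (forall v, {vspace lat_red (L v)}), is_subrep N ->
        exists (n : nat) (S : 'I_n -> forall v, {vspace lat_red (L v)}),
          [/\ forall i, is_subrep (S i),
              is_direct_sum N S,
              forall i, exists v (x : lat_red (L v)), generated_by (S i) x
            & forall i v, (\dim (S i v) <= 1)%N],
      qprojective (config_rep L)
    & in_apartment L].
Proof.
have [I HI] := lwi_independent_system d_gt0 L_convex L_lwi.
have [Gamma_gt0 _ _] := L_convex.
have [n [src [x bP]]] := projective_basis d_gt0 L_convex HI.
split; last exact: projective_in_apartment bP.
  by move=> N; apply: subrep_sum_of_lines HI N.
exact: config_rep_projective HI.
Qed.
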